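(* Let $R$ be a commutative ring with unit, let $(A,(\mu_n)_{n\in\mathbb N})$ be an $A_\infty$-algebra over $R$ and let $(M,(\mu^M_{r,s})_{r,s\in\mathbb N_0})$ be an $A_\infty$-bimodule over $A$. Let $b:CH_*(A;M)\to CH_*(A;M)$ be the Hochschild differential of $A$ with coefficients in $M$. Then $b\circ b=0$, i.e. $b$ is a differential on $CH_*(A;M)$ which lowers degree by one.
   Context: Conventions: $\mathbb N=\{1,2,\dots\}$, $\mathbb N_0=\mathbb N\cup\{0\}$, $\otimes=\otimes_R$, graded modules are $\mathbb Z$-graded, empty sums are $0$. Formulas containing signs are stated for homogeneous elements and extended $R$-linearly. For $a\in A_j$ write $\mu(a)=j$ and $\|a\|=\mu(a)-1$ (reduced index). For $m\in M_j$ write $\mu(m)=\mu_M(m)=j$. For $a_1,\dots,a_n\in A$ put $\maltese_i^j=\sum_{q=i}^j\|a_q\|$ for $1\le i\le j\le n$ ($0$ if $j<i$). $A_\infty$-algebra: a graded $R$-module $A=\bigoplus_j A_j$ with graded $R$-module homomorphisms $\mu_n:A^{\otimes n}\to A$ of degree $2-n$ ($n\in\mathbb N$) such that for all $r\in\mathbb N$ and $a_1,\dots,a_r\in A$ $$\sum_{n_1,n_2\in\mathbb N,\ n_1+n_2=r+1}\ \sum_{i=1}^{r+1-n_1}(-1)^{\maltese_1^{i-1}}\mu_{n_2}(a_1,\dots,a_{i-1},\mu_{n_1}(a_i,\dots,a_{i+n_1-1}),a_{i+n_1},\dots,a_r)=0.$$ $A_\infty$-bimodule over $A$: a graded $R$-module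 $M=\bigoplus_jM_j$ with $R$-module homomorphisms $\mu^M_{r,s}:A^{\otimes r}\otimes M\otimes A^{\otimes s}\to M$ of degree $1-r-s$ ($r,s\in\mathbb N_0$) such that for all $r,s\in\mathbb N_0$, $m\in M$, $a_1,\dots,a_{r+s}\in A$ (with $\maltese$ computed from the $a_q$ only): $$\sum_{r_1\in\mathbb N_0,r_2\in\mathbb N,\ r_1+r_2=r+1}\sum_{i=1}^{r_1}(-1)^{\maltese_1^{i-1}}\mu^M_{r_1,s}(a_1,\dots,\mu_{r_2}(a_i,\dots,a_{i+r_2-1}),\dots,a_r,m,a_{r+1},\dots,a_{r+s})$$ $$+\sum_{r_1+r_2=r}\ \sum_{s_1+s_2=s}(-1)^{\maltese_1^{r_1}}\mu^M_{r_1,s_1}(a_1,\dots,a_{r_1},\mu^M_{r_2,s_2}(a_{r_1+1},\dots,a_r,m,a_{r+1},\dots,a_{r+s_2}),a_{r+s_2+1},\dots,a_{r+s})$$ $$+\sum_{s_1\in\mathbb N_0,s_2\in\mathbb N,\ s_1+s_2=s+1}\sum_{j=1}^{s_1}(-1)^{\maltese_1^{r+j-1}+\mu_M(m)}\mu^M_{r,s_1}(a_1,\dots,a_r,m,a_{r+1},\dots,a_{r+j-1},\mu_{s_2}(a_{r+j},\dots,a_{r+j+s_2-1}),\dots,a_{r+s})=0,$$ where in the second line $r_1,r_2,s_1,s_2\in\mathbb N_0$. Hochschild chains: $CH_*(A;M)=\bigoplus_{n\ge0}M\otimes A^{\otimes n}$, graded by $\deg(m\otimes a_1\otimes\dots\otimes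 a_n)=n-\mu(m)-\sum_{q=1}^n\mu(a_q)=-\mu(m)-\sum_{q=1}^n\|a_q\|$; $CH_j(A;M)$ is the part of degree $j$. For $m\otimes a_1\otimes\dots\otimes a_n$ put $\maltese_0^i=\mu(m)+\maltese_1^i$ and $*_{i-1}=\maltese_0^{i-1}\cdot\maltese_i^n$. For $n\in\mathbb N_0$, $1\le l\le n+1$, $0\le i\le n$ define $b_{i,l}(m\otimes a_1\otimes\dots\otimes a_n)\in M\otimes A^{\otimes(n-l+1)}$ by: - $i=0$: $\mu^M_{0,l-1}(m,a_1,\dots,a_{l-1})\otimes a_l\otimes\dots\otimes a_n$; - $1\le i\le n-l+1$: $(-1)^{\maltese_0^{i-1}}\,m\otimes a_1\otimes\dots\otimes a_{i-1}\otimes\mu_l(a_i,\dots,a_{i+l-1})\otimes a_{i+l}\otimes\dots\otimes a_n$; - $n-l+2\le i\le n$, $i\geq 1$: $(-1)^{*_{i-1}}\,\mu^M_{n-i+1,\,i+l-n-2}(a_i,\dots,a_n,m,a_1,\dots,a_{i+l-n-2})\otimes a_{i+l-n-1}\otimes\dots\otimes a_{i-1}$; and $b_{i,l}=0$ on $M\otimes A^{\otimes n}$ if $l>n+1$ or $i>n$, except that the $i=0$ formula applies also for $n=0$. The Hochschild differential is $b=\sum_{l\in\mathbb N}\sum_{i\in\mathbb N_0}b_{i,l}$. *)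

(* Defs.v *)
From HB Require Import structures.
From mathcomp Require Import all_boot all_order all_algebra.
From mathcomp Require Import generic_quotient ring_quotient boolp zify.

Set Implicit Arguments.
Unset Strict Implicit.
Unset Printing Implicit Defensive.

Import GRing.Theory.
Local Open Scope ring_scope.

Section LinearMisc.
Variables (R : pzRingType) (U V : lmodType R).

Definition linfun_of (f : U -> V) of linear f := f.
HB.instance Definition _ f (lf : linear f) :=
  GRing.isLinear.Build R U V *:%R (linfun_of lf) lf.

Inductive lin_span (P : V -> Prop) : V -> Prop :=
| Span0 : lin_span P 0
| SpanZD c x y : P x -> lin_span P y -> lin_span P (c *: x + y).

Lemma lin_span_incl (P : V -> Prop) x : P x -> lin_span P x.
Proof. by move=> Px; rewrite -[x]addr0 -[x]scale1r; apply/SpanZD/Span0. Qed.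

Lemma lin_spanD (P : V -> Prop) x y :
  lin_span P x -> lin_span P y -> lin_span P (x + y).
Proof.
by move=> + Py; elim=> [|c u v Pu _ IH]; rewrite ?add0r // -addrA; apply: SpanZD.
Qed.

Lemma lin_spanZ (P : V -> Prop) c x : lin_span P x -> lin_span P (c *: x).
Proof.
elim=> [|d u v Pu _ IH]; first by rewrite scaler0; apply: Span0.
by rewrite scalerDr scalerA; apply: SpanZD.
Qed.

End LinearMisc.

Lemma lin_comb (R : comPzRingType) (U V : lmodType R) (f g : {linear U -> V}) c :
  linear (fun t => c *: f t + g t).
Proof.
move=> d x y; rewrite (linearP f) (linearP g) !scalerDr !scalerA (mulrC c d).
by rewrite addrACA.
Qed.

Record dsum (R : pzRingType) (I : eqType) (V : I -> lmodType R) := DSum {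
  dsum_fun :> forall i, V i;
  dsum_fin : exists s : seq I, forall i, i \notin s -> dsum_fun i = 0 }.

Section DirectSum.
Variables (R : pzRingType) (I : eqType) (V : I -> lmodType R).
Implicit Types u v w : dsum V.

Lemma dsumP u v : (forall i, u i = v i) -> u = v.
Proof.
case: u v => [f pf] [g pg] /= fg.
have {}fg : f = g by apply: functional_extensionality_dep.
by subst g; congr DSum; apply: Prop_irrelevance.
Qed.

HB.instance Definition _ := gen_eqMixin (dsum V).
HB.instance Definition _ := gen_choiceMixin (dsum V).

Fact dsum0_fin : exists s : seq I, forall i, i \notin s -> (0 : V i) = 0.
Proof. by exists [::]. Qed.
Definition dsum0 : dsum V := DSum dsum0_fin.

Fact dsumN_fin u : exists s : seq I, forall i, i \notin s -> - u i = 0.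
Proof. by have [s Hs] := dsum_fin u; exists s => i /Hs ->; rewrite oppr0. Qed.
Definition dsumN u : dsum V := DSum (dsumN_fin u).

Fact dsumD_fin u v : exists s : seq I, forall i, i \notin s -> u i + v i = 0.
Proof.
have [s Hs] := dsum_fin u; have [t Ht] := dsum_fin v.
by exists (s ++ t) => i; rewrite mem_cat negb_or => /andP[/Hs-> /Ht->]; rewrite addr0.
Qed.
Definition dsumD u v : dsum V := DSum (dsumD_fin u v).

Fact dsumZ_fin c u : exists s : seq I, forall i, i \notin s -> c *: u i = 0.
Proof. by have [s Hs] := dsum_fin u; exists s => i /Hs ->; rewrite scaler0. Qed.
Definition dsumZ c u : dsum V := DSum (dsumZ_fin c u).

Fact dsum_addA : associative dsumD.
Proof. by move=> u v w; apply: dsumP => i /=; rewrite addrA. Qed.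
Fact dsum_addC : commutative dsumD.
Proof. by move=> u v; apply: dsumP => i /=; rewrite addrC. Qed.
Fact dsum_add0 : left_id dsum0 dsumD.
Proof. by move=> u; apply: dsumP => i /=; rewrite add0r. Qed.
Fact dsum_addN : left_inverse dsum0 dsumN dsumD.
Proof. by move=> u; apply: dsumP => i /=; rewrite addNr. Qed.
HB.instance Definition _ :=
  GRing.isZmodule.Build (dsum V) dsum_addA dsum_addC dsum_add0 dsum_addN.

Fact dsum_scaleA a b u : dsumZ a (dsumZ b u) = dsumZ (a * b) u.
Proof. by apply: dsumP => i /=; rewrite scalerA. Qed.
Fact dsum_scale1 : left_id 1 dsumZ.
Proof. by move=> u; apply: dsumP => i /=; rewrite scale1r. Qed.
Fact dsum_scaleDr : right_distributive dsumZ +%R.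
Proof. by move=> a u v; apply: dsumP => i /=; rewrite scalerDr. Qed.
Fact dsum_scaleDl u : {morph dsumZ^~ u : a b / a + b}.
Proof. by move=> a b; apply: dsumP => i /=; rewrite scalerDl. Qed.
HB.instance Definition _ := GRing.Zmodule_isLmodule.Build R (dsum V)
  dsum_scaleA dsum_scale1 dsum_scaleDr dsum_scaleDl.

Lemma dsumE0 i : (0 : dsum V) i = 0. Proof. by []. Qed.
Lemma dsumED u v i : (u + v) i = u i + v i. Proof. by []. Qed.
Lemma dsumEZ c u i : (c *: u) i = c *: u i. Proof. by []. Qed.

Definition dinj_fun i (x : V i) (j : I) : V j :=
  if i =P j is ReflectT e then ecast k (V k) e x else 0.

Fact dinj_fin i (x : V i) :
  exists s : seq I, forall j, j \notin s -> dinj_fun x j = 0.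
Proof.
exists [:: i] => j; rewrite inE => ne; rewrite /dinj_fun.
by case: (i =P j) => // e; case/eqP: ne.
Qed.
Definition dinj i (x : V i) : dsum V := DSum (dinj_fin x).

Lemma dinj_same i (x : V i) : dinj x i = x.
Proof. by rewrite /= /dinj_fun; case: eqP => // e; rewrite eq_axiomK. Qed.

Lemma dinj_neq i j (x : V i) : i != j -> dinj x j = 0.
Proof. by rewrite /= /dinj_fun; case: eqP. Qed.

Fact dinj_linear i : linear (@dinj i).
Proof.
move=> c x y; apply: dsumP => j; rewrite dsumED dsumEZ.
have [<-|ne] := eqVneq i j; first by rewrite !dinj_same.
by rewrite !dinj_neq // scaler0 addr0.
Qed.
HB.instance Definition _ i :=
  GRing.isLinear.Build R (V i) (dsum V) *:%R (@dinj i) (@dinj_linear i).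

Lemma dsum_sumE (J : Type) (r : seq J) (F : J -> dsum V) i :
  (\sum_(j <- r) F j) i = \sum_(j <- r) F j i.
Proof. by elim/big_rec2: _ => // j x u _ <-. Qed.

Lemma dsum_decomp u (s : seq I) : uniq s -> (forall i, i \notin s -> u i = 0) ->
  u = \sum_(i <- s) dinj (u i).
Proof.
move=> us Hs; apply: dsumP => j; rewrite dsum_sumE.
have [js|js] := boolP (j \in s).
  rewrite (bigD1_seq j) // dinj_same big1 => [|i ne].
    exact/esym/addr0.
  exact: dinj_neq.
rewrite Hs // big_seq big1 // => i si; apply: dinj_neq.
by apply: contraNneq js => <-.
Qed.

Lemma dsum_ind u : exists s : seq I, u = \sum_(i <- s) dinj (u i).
Proof.
have [s Hs] := dsum_fin u; exists (undup s).
by apply: dsum_decomp (undup_uniq s) _ => i; rewrite mem_undup; apply: Hs.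
Qed.

Lemma dsum_lin_uniq (W : lmodType R) (f g : {linear dsum V -> W}) :
  (forall i (x : V i), f (dinj x) = g (dinj x)) -> f =1 g.
Proof.
move=> fg u; have [s ->] := dsum_ind u.
by rewrite !linear_sum; apply: eq_bigr => i _; apply: fg.
Qed.

Section Lift.
Variables (W : lmodType R) (f : forall i, {linear V i -> W}).

Definition dlift_fun u : W :=
  \sum_(i <- undup (projT1 (cid (dsum_fin u)))) f i (u i).

Lemma dlift_funE u (s : seq I) : uniq s -> (forall i, i \notin s -> u i = 0) ->
  dlift_fun u = \sum_(i <- s) f i (u i).
Proof.
move=> us Hs; rewrite /dlift_fun; case: cid => t /= Ht.
rewrite (bigID (mem s)) /= [X in _ + X]big1 ?addr0; last first.
  by move=> i /Hs->; rewrite linear0.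
rewrite [RHS](bigID (mem t)) /= [X in _ + X]big1 ?addr0; last first.
  by move=> i /Ht->; rewrite linear0.
rewrite -[LHS]big_filter -[RHS]big_filter; apply: perm_big; apply: uniq_perm.
- exact/filter_uniq/undup_uniq.
- exact: filter_uniq.
by move=> i; rewrite !mem_filter mem_undup andbC.
Qed.

Lemma dlift_linear : linear dlift_fun.
Proof.
move=> c u v; have [s Hs] := dsum_fin u; have [t Ht] := dsum_fin v.
have ur : uniq (undup (s ++ t)) by apply: undup_uniq.
have Hu i : i \notin undup (s ++ t) -> u i = 0.
  by rewrite mem_undup mem_cat negb_or => /andP[/Hs].
have Hv i : i \notin undup (s ++ t) -> v i = 0.
  by rewrite mem_undup mem_cat negb_or => /andP[_ /Ht].
have Huv i : i \notin undup (s ++ t) -> (c *: u + v) i = 0.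
  by move=> Hi; rewrite dsumED dsumEZ Hu // Hv // scaler0 addr0.
rewrite (dlift_funE ur Hu) (dlift_funE ur Hv) (dlift_funE ur Huv).
by rewrite scaler_sumr -big_split; apply: eq_bigr => i _; rewrite /= linearP.
Qed.

Lemma dlift : exists L : {linear dsum V -> W},
  forall i (x : V i), L (dinj x) = f i x.
Proof.
exists (linfun_of dlift_linear) => i x.
rewrite [LHS](@dlift_funE _ [:: i]) ?big_seq1 ?dinj_same // => j.
by rewrite inE eq_sym => /dinj_neq ->.
Qed.

End Lift.
End DirectSum.

Section Tensor.
Variables (R : comPzRingType) (V W : lmodType R).

Definition free_on_pairs := dsum (fun _ : V * W => (R^o : lmodType R)).

Definition gen (v : V) (w : W) : free_on_pairs :=
  dinj (V := fun _ : V * W => (R^o : lmodType R)) (i := (v, w)) (1 : R).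

Inductive bilin_rel : free_on_pairs -> Prop :=
| BilinDl v v' w : bilin_rel (gen (v + v') w - gen v w - gen v' w)
| BilinDr v w w' : bilin_rel (gen v (w + w') - gen v w - gen v w')
| BilinZl c v w : bilin_rel (gen (c *: v) w - c *: gen v w)
| BilinZr c v w : bilin_rel (gen v (c *: w) - c *: gen v w).

Definition tensor_null : {pred free_on_pairs} :=
  fun x => `[< lin_span bilin_rel x >].

Fact tensor_null_zmod : zmod_closed tensor_null.
Proof.
split=> [|x y]; rewrite !unfold_in; first exact/asboolP/Span0.
move=> /asboolP Hx /asboolP Hy; apply/asboolP/lin_spanD => //.
by rewrite -scaleN1r; apply: lin_spanZ.
Qed.
HB.instance Definition _ :=
  GRing.isZmodClosed.Build free_on_pairs tensor_null tensor_null_zmod.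

Definition tensor : Type := Quotient.quot tensor_null.
HB.instance Definition _ := GRing.Zmodule.on tensor.

Definition tensor_pi (x : free_on_pairs) : tensor :=
  \pi_(Quotient.quot tensor_null)%qT x.
Definition tensor_repr (x : tensor) : free_on_pairs :=
  repr (x : Quotient.quot tensor_null).

Lemma tensor_reprK : cancel tensor_repr tensor_pi.
Proof. exact: reprK. Qed.

Lemma tensor_piE x y : tensor_pi x = tensor_pi y <-> lin_span bilin_rel (x - y).
Proof.
split=> [/eqP|H]; first by rewrite -Quotient.idealrBE => /asboolP.
by apply/eqP; rewrite -Quotient.idealrBE; apply/asboolP.
Qed.

Lemma tensor_piD x y : tensor_pi (x + y) = tensor_pi x + tensor_pi y.
Proof. exact: (raddfD \pi_(Quotient.quot tensor_null)%qT). Qed.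

Definition tensor_scale (c : R) (x : tensor) : tensor :=
  tensor_pi (c *: tensor_repr x).

Fact tensor_scale_pi c x : tensor_scale c (tensor_pi x) = tensor_pi (c *: x).
Proof.
apply/tensor_piE; rewrite -scalerBr; apply: lin_spanZ.
by apply/tensor_piE; rewrite tensor_reprK.
Qed.

Fact tensor_scaleA a b x :
  tensor_scale a (tensor_scale b x) = tensor_scale (a * b) x.
Proof. by rewrite -[x]tensor_reprK !tensor_scale_pi scalerA. Qed.
Fact tensor_scale1 : left_id 1 tensor_scale.
Proof. by move=> x; rewrite -[x]tensor_reprK tensor_scale_pi scale1r. Qed.
Fact tensor_scaleDr : right_distributive tensor_scale +%R.
Proof.
move=> a x y; rewrite -[x]tensor_reprK -[y]tensor_reprK.
by rewrite -tensor_piD !tensor_scale_pi scalerDr tensor_piD.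
Qed.
Fact tensor_scaleDl x : {morph tensor_scale^~ x : a b / a + b}.
Proof.
by move=> a b; rewrite -[x]tensor_reprK !tensor_scale_pi scalerDl tensor_piD.
Qed.
HB.instance Definition _ := GRing.Zmodule_isLmodule.Build R tensor
  tensor_scaleA tensor_scale1 tensor_scaleDr tensor_scaleDl.

Fact tensor_pi_linear : linear tensor_pi.
Proof. by move=> c x y; rewrite tensor_piD -tensor_scale_pi. Qed.
HB.instance Definition _ := GRing.isLinear.Build R free_on_pairs tensor *:%R
  tensor_pi tensor_pi_linear.

Definition tens (v : V) (w : W) : tensor := tensor_pi (gen v w).

Let subr_split (a b d e : free_on_pairs) : a - (d + e) = (a - b - e) + (b - d).
Proof. by rewrite [a - b - e]addrAC addrA subrK opprD addrA addrAC. Qed.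

Lemma tens_linearr v : linear (tens v).
Proof.
move=> c x y; rewrite /tens -linearZ -linearD; apply/tensor_piE.
rewrite (subr_split _ (gen v (c *: x))).
by apply: lin_spanD; apply: lin_span_incl; [apply: BilinDr|apply: BilinZr].
Qed.

Lemma tens_linearl w : linear (tens^~ w).
Proof.
move=> c x y; rewrite /tens -linearZ -linearD; apply/tensor_piE.
rewrite (subr_split _ (gen (c *: x) w)).
by apply: lin_spanD; apply: lin_span_incl; [apply: BilinDl|apply: BilinZl].
Qed.

HB.instance Definition _ v :=
  GRing.isLinear.Build R W tensor *:%R (tens v) (tens_linearr v).

Lemma tensor_lin_uniq (U : lmodType R) (f g : {linear tensor -> U}) :
  (forall v w, f (tens v w) = g (tens v w)) -> f =1 g.
Proof.
move=> fg x; rewrite -[x]tensor_reprK.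
rewrite -[LHS]/((f \o tensor_pi) _) -[RHS]/((g \o tensor_pi) _).
apply: dsum_lin_uniq => -[v w] c.
rewrite -[c]mulr1 -[c * 1]/(c *: (1 : R^o)) !linearZ /=; congr (_ *: _).
exact: fg.
Qed.

Lemma tensor_lift (U : lmodType R) (B : V -> W -> U) :
  (forall w, linear (B^~ w)) -> (forall v, linear (B v)) ->
  exists L : {linear tensor -> U}, forall v w, L (tens v w) = B v w.
Proof.
move=> Bl Br.
have lin1 p : linear (fun c : R^o => c *: B p.1 p.2).
  by move=> a c d; rewrite scalerDl scalerA.
have [F HF] := dlift (fun p => linfun_of (lin1 p)).
have Fgen v w : F (gen v w) = B v w by rewrite HF; apply: scale1r.
have FZ c (u : free_on_pairs) : F (c *: u) = c *: F u by exact: linearZ_LR.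
have Frel u : bilin_rel u -> F u = 0.
  case=> [v v' w|v w w'|a v w|a v w].
  - rewrite 2!(raddfB F) /= !Fgen; have := Bl w 1 v v'.
    by rewrite /= !scale1r => ->; rewrite -addrA -opprD subrr.
  - rewrite 2!(raddfB F) /= !Fgen; have := Br v 1 w w'.
    by rewrite /= !scale1r => ->; rewrite -addrA -opprD subrr.
  - rewrite (raddfB F) /= FZ !Fgen; apply/eqP; rewrite subr_eq0; apply/eqP.
    exact: (linearZ_LR (linfun_of (Bl w))).
  - rewrite (raddfB F) /= FZ !Fgen; apply/eqP; rewrite subr_eq0; apply/eqP.
    exact: (linearZ_LR (linfun_of (Br v))).
have F0 x : lin_span bilin_rel x -> F x = 0.
  elim=> [|c u y Hu _ IH]; first by rewrite linear0.
  by rewrite linearP IH addr0 Frel ?scaler0.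
have Fpi x : F (tensor_repr (tensor_pi x)) = F x.
  apply/eqP; rewrite -subr_eq0 -linearB; apply/eqP/F0.
  by apply/tensor_piE; rewrite tensor_reprK.
have Llin : linear (fun x => F (tensor_repr x)).
  move=> c x y; rewrite -[x]tensor_reprK -[y]tensor_reprK -linearP !Fpi.
  by rewrite linearP.
by exists (linfun_of Llin) => v w; rewrite -[LHS]/(F _) Fpi Fgen.
Qed.

End Tensor.

Section TensorPower.
Variables (R : comPzRingType) (V : lmodType R).

Fixpoint tpow (n : nat) : lmodType R :=
  if n is n'.+1 then tensor V (tpow n') else R^o.

Fixpoint ptens (s : seq V) : tpow (size s) :=
  if s is v :: s' then tens v (ptens s') else (1 : R).

Lemma ptens_linear (W : lmodType R) (L : forall n, {linear tpow n -> W})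
    s1 c x y s2 (f := fun s => L (size s) (ptens s)) :
  f (s1 ++ c *: x + y :: s2) = c *: f (s1 ++ x :: s2) + f (s1 ++ y :: s2).
Proof.
rewrite {}/f; elim: s1 L => [|a s1 IH] L /=; first by rewrite tens_linearl linearP.
exact: (IH (fun n => L n.+1 \o tens a)).
Qed.

End TensorPower.

(* A graded module is a family [A : int -> lmodType R] with total module [dsum A];
   [hel A] is the type of homogeneous elements together with a degree, so that
   the zero element occurs once in each degree. *)

Section Graded.
Variables (R : comPzRingType) (A : int -> lmodType R).

Definition hel := {j : int & A j}.
Definition hval (a : hel) : dsum A := dinj (tagged a).

Definition homogeneous (d : int) (x : dsum A) := exists y : A d, x = dinj y.

Definition rdeg (a : hel) : int := tag a - 1.

End Graded.

Definition sgn (R : pzRingType) (k : int) : R := (-1) ^+ `|k|%N.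

(* The subsequence s_i, ..., s_j of s, entries being numbered from 1; it is empty
   when j = i - 1. *)
Definition slice (T : Type) (s : seq T) (i j : nat) : seq T :=
  take (j.+1 - i)%N (drop i.-1 s).

Lemma slice_ins (T : Type) (s1 s2 : seq T) i j : (0 < i)%N ->
  ((i <= (size s1).+1 <= j)%N /\
     exists t1 t2, forall v, slice (s1 ++ v :: s2) i j = t1 ++ v :: t2) \/
  (~~ (i <= (size s1).+1 <= j)%N /\
     exists t, forall v, slice (s1 ++ v :: s2) i j = t).
Proof.
move=> i0; case: (boolP (i <= _ <= j)%N) => H; [left|right]; split=> //.
  exists (drop i.-1 s1), (take (j - (size s1).+1) s2) => v; rewrite /slice drop_cat.
  case: ltnP => Hi; last first.
    rewrite (_ : i.-1 - size s1 = 0)%N; last lia.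
    rewrite drop0 drop_oversize //= (_ : j.+1 - i = (j - (size s1).+1).+1)%N //; lia.
  rewrite take_cat size_drop ltnNge (_ : (_ <= _)%N = true) /=; last lia.
  by rewrite (_ : j.+1 - i - _ = (j - (size s1).+1).+1)%N //; lia.
rewrite /slice; case: (leqP i (size s1).+1) H => [Hi H|Hi _].
  exists (take (j.+1 - i) (drop i.-1 s1)) => v; rewrite drop_cat.
  case: ltnP => Hs.
    rewrite take_cat size_drop; case: ltnP => // Hj.
    by rewrite (_ : j.+1 - i - _ = 0)%N ?take0 ?cats0 ?take_oversize ?size_drop //; lia.
  by rewrite (_ : j.+1 - i = 0)%N ?take0 //; lia.
have [k Ek] : exists k, (i.-1 - size s1 = k.+1)%N.
  by exists (i.-1 - size s1).-1; lia.
exists (take (j.+1 - i) (drop k s2)) => v.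
by rewrite drop_cat ltnNge (_ : (_ <= _)%N = true) ?Ek //; lia.
Qed.

(* \maltese_i^j, the sum of the reduced degrees of a_i, ..., a_j. *)
Definition mcross (R : comPzRingType) (A : int -> lmodType R)
    (a : seq (hel A)) (i j : nat) : int :=
  \sum_(x <- slice a i j) rdeg x.

Section GradedTensor.
Variables (R : comPzRingType) (A : int -> lmodType R).

Lemma hval_linear j c (x y : A j) :
  hval (Tagged A (c *: x + y)) = c *: hval (Tagged A x) + hval (Tagged A y).
Proof. exact: (linearP (@dinj R int A j)). Qed.

Lemma dsum_hvals (u : dsum A) : exists s : seq (hel A), u = \sum_(a <- s) hval a.
Proof.
have [s Es] := dsum_ind u; exists [seq Tagged A (u j) | j <- s].
by rewrite big_map.
Qed.

Lemma tensor_hval_uniq (T W : lmodType R) (f g : {linear tensor (dsum A) T -> W}) :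
  (forall a t, f (tens (hval a) t) = g (tens (hval a) t)) -> f =1 g.
Proof.
move=> fg; apply: tensor_lin_uniq => v t.
rewrite -[LHS]/((f \o linfun_of (tens_linearl t)) v).
rewrite -[RHS]/((g \o linfun_of (tens_linearl t)) v).
by apply: dsum_lin_uniq => j x; apply: (fg (Tagged A x)).
Qed.

Lemma tensor_hval_lift (T W : lmodType R) (H : hel A -> {linear T -> W}) :
  (forall j c (x y : A j) t,
     H (Tagged A (c *: x + y)) t = c *: H (Tagged A x) t + H (Tagged A y) t) ->
  exists L : {linear tensor (dsum A) T -> W},
    forall a t, L (tens (hval a) t) = H a t.
Proof.
move=> Hlin.
have Hl t j : linear (fun x : A j => H (Tagged A x) t) by move=> c x y; apply: Hlin.
have /choice[B HB] t := dlift (fun j => linfun_of (Hl t j)).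
have Br v : linear (fun t => B t v).
  move=> c t t'; have [s ->] := dsum_ind v; rewrite !linear_sum ?scaler_sumr.
  by rewrite -big_split; apply: eq_bigr => j _; rewrite /= !HB [LHS]linearP.
have [L HL] := @tensor_lift R (dsum A) T W (fun v t => B t v)
  (fun t => @linearP _ _ _ _ (B t)) Br.
by exists L => -[j x] t; rewrite HL [LHS]HB.
Qed.

Fixpoint ptens_at n (s : seq (dsum A)) : tpow (dsum A) n :=
  if n is n'.+1 return tpow (dsum A) n then
    tens (head 0 s) (ptens_at n' (behead s)) else (1 : R).

Lemma ptens_atE s : ptens_at (size s) s = ptens s.
Proof. by elim: s => //= v s ->. Qed.

Lemma tpow_hval_uniq (W : lmodType R) n (f g : {linear tpow (dsum A) n -> W}) :
  (forall a, size a = n ->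
     f (ptens_at n (map (@hval R A) a)) = g (ptens_at n (map (@hval R A) a))) ->
  f =1 g.
Proof.
elim: n => [|n IH] in f g * => fg.
  move=> c; rewrite -[c]mulr1 -[c * 1]/(c *: (1 : R^o)).
  by rewrite [LHS]linearZ [RHS]linearZ; congr (_ *: _); apply: (fg [::]).
apply: tensor_hval_uniq => a.
apply: (IH (f \o tens (hval a)) (g \o tens (hval a))) => s Hs.
by apply: (fg (a :: s)); rewrite /= Hs.
Qed.

Definition hmultilinear (W : lmodType R) n (G : seq (hel A) -> W) :=
  forall s1 j c (x y : A j) s2, (size s1 + (size s2).+1)%N = n ->
    G (s1 ++ Tagged A (c *: x + y) :: s2) =
    c *: G (s1 ++ Tagged A x :: s2) + G (s1 ++ Tagged A y :: s2).

Lemma tpow_hval_lift (W : lmodType R) n (G : seq (hel A) -> W) :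
  hmultilinear n G ->
  exists L : {linear tpow (dsum A) n -> W},
    forall a, size a = n -> L (ptens_at n (map (@hval R A) a)) = G a.
Proof.
elim: n => [|n IH] in G * => HG.
  have lin1 : linear (fun c : R^o => c *: G [::]).
    by move=> a c d; rewrite scalerDl scalerA.
  by exists (linfun_of lin1) => -[|//] _; apply: scale1r.
have /choice[H HH] a : exists L : {linear tpow (dsum A) n -> W}, forall s,
    size s = n -> L (ptens_at n (map (@hval R A) s)) = G (a :: s).
  by apply: (IH (fun s => G (a :: s))) => s1 j c x y s2 Hs; apply: (HG (a :: s1)); rewrite -Hs.
have [j c x y t|L HL] := @tensor_hval_lift (tpow (dsum A) n) W H.
  have lin2 := lin_comb (H (Tagged A x)) (H (Tagged A y)) c.
  rewrite -[RHS]/(linfun_of lin2 t).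
  apply: tpow_hval_uniq => a Ha; rewrite HH // -[RHS]/(c *: H (Tagged A x) _ + H (Tagged A y) _) !HH //.
  by apply: (HG [::]); rewrite -Ha.
by exists L => -[//|a s] [Hs]; rewrite [LHS]HL HH.
Qed.

End GradedTensor.

Lemma mcross_tag (R : comPzRingType) (A : int -> lmodType R) (a a' : seq (hel A)) i j :
  map (@tag _ _) a = map (@tag _ _) a' -> mcross a i j = mcross a' i j.
Proof.
have E (b : seq (hel A)) : mcross b i j = \sum_(t <- slice (map (@tag _ _) b) i j) (t - 1).
  by rewrite /mcross /slice -map_drop -map_take big_map.
by rewrite !E => ->.
Qed.

Section Ainfty.
Variables (R : comPzRingType) (A M : int -> lmodType R).

(* [mu n] is the operation with n + 1 inputs, [mu_seq] applies the operation whose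
   arity is the length of the list; its value on the empty list is a dummy. *)
Variable mu : forall n, {linear tpow (dsum A) n.+1 -> dsum A}.
Variable muM : forall r s,
  {linear tensor (tpow (dsum A) r) (tensor (dsum M) (tpow (dsum A) s)) -> dsum M}.

Definition mu_seq (s : seq (dsum A)) : dsum A :=
  if s is v :: s' then mu (size s') (ptens (v :: s')) else 0.

Definition muM_seq (u : seq (dsum A)) (m : dsum M) (v : seq (dsum A)) : dsum M :=
  muM (size u) (size v) (tens (ptens u) (tens m (ptens v))).

Definition ainfty_algebra : Prop :=
  (forall a : seq (hel A), (0 < size a)%N ->
    homogeneous (\sum_(y <- a) tag y + 2 - (size a)%:Z) (mu_seq (map (@hval R A) a)))
  /\
  (forall a : seq (hel A), (0 < size a)%N ->
    let r := size a in let x := map (@hval R A) a in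
    \sum_(1 <= n1 < r.+1) \sum_(1 <= i < (r.+2 - n1)%N)
      sgn R (mcross a 1 i.-1) *:
        mu_seq (slice x 1 i.-1 ++ mu_seq (slice x i (i + n1).-1)
                :: slice x (i + n1) r) = 0).

Definition ainfty_bimodule : Prop :=
  (forall (a : seq (hel A)) (m : hel M) (a' : seq (hel A)),
    homogeneous (\sum_(y <- a) tag y + tag m + \sum_(y <- a') tag y
                 + 1 - (size a)%:Z - (size a')%:Z)
      (muM_seq (map (@hval R A) a) (hval m) (map (@hval R A) a')))
  /\
  (forall (r s : nat) (a : seq (hel A)) (m : hel M), size a = (r + s)%N ->
    let x := map (@hval R A) a in
    \sum_(0 <= r1 < r.+1) \sum_(1 <= i < r1.+1)
      (let r2 := (r.+1 - r1)%N in
       sgn R (mcross a 1 i.-1) *: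
         muM_seq (slice x 1 i.-1 ++ mu_seq (slice x i (i + r2).-1)
                  :: slice x (i + r2) r)
                 (hval m)
                 (slice x r.+1 (r + s)))
    + \sum_(0 <= r1 < r.+1) \sum_(0 <= s2 < s.+1)
      sgn R (mcross a 1 r1) *:
        muM_seq (slice x 1 r1)
                (muM_seq (slice x r1.+1 r) (hval m) (slice x r.+1 (r + s2)))
                (slice x (r + s2).+1 (r + s))
    + \sum_(0 <= s1 < s.+1) \sum_(1 <= j < s1.+1)
      (let s2 := (s.+1 - s1)%N in
       sgn R (mcross a 1 (r + j).-1 + tag m) *:
         muM_seq (slice x 1 r)
                 (hval m)
                 (slice x r.+1 (r + j).-1 ++ mu_seq (slice x (r + j) (r + j + s2).-1)
                  :: slice x (r + j + s2) (r + s)))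
    = 0).

Definition CH_length (n : nat) : lmodType R := tensor (dsum M) (tpow (dsum A) n).

Definition CH : lmodType R := dsum CH_length.

Definition chain (m : dsum M) (s : seq (dsum A)) : CH :=
  dinj (V := CH_length) (i := size s) (tens m (ptens s)).

Definition CH_part (j : int) : CH -> Prop :=
  lin_span (fun x => exists (m : hel M) (a : seq (hel A)),
    x = chain (hval m) (map (@hval R A) a) /\
    j = (size a)%:Z - tag m - \sum_(y <- a) tag y).

(* The value of b_{i,l} on m (x) a_1 (x) ... (x) a_n, for l >= 1. *)
Definition b_term (i l : nat) (m : hel M) (a : seq (hel A)) : CH :=
  let n := size a in
  let x := map (@hval R A) a in
  let mcross0 k := tag m + mcross a 1 k in
  if (n.+1 < l)%N || (n < i)%N then 0
  else if i == 0%N then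
    chain (muM_seq [::] (hval m) (slice x 1 l.-1)) (slice x l n)
  else if (i <= n.+1 - l)%N then
    sgn R (mcross0 i.-1) *:
      chain (hval m) (slice x 1 i.-1 ++ mu_seq (slice x i (i + l).-1)
                      :: slice x (i + l) n)
  else
    sgn R (mcross0 i.-1 * mcross a i n) *:
      chain (muM_seq (slice x i n) (hval m) (slice x 1 (i + l - n - 2)%N))
            (slice x (i + l - n - 1)%N i.-1).

(* b is the sum of the b_{i,l} over l >= 1 and i >= 0, extended linearly from
   homogeneous pure tensors; the terms with l > n + 1 or i > n are zero. *)
Definition is_hochschild (b : {linear CH -> CH}) : Prop :=
  forall (m : hel M) (a : seq (hel A)),
    b (chain (hval m) (map (@hval R A) a)) =
    \sum_(1 <= l < (size a).+2) \sum_(0 <= i < (size a).+1) b_term i l m a.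

Let Lmu n : {linear tpow (dsum A) n -> dsum A} :=
  if n is n'.+1 then mu n' else \0.

Lemma mu_seq_linear s1 c x y s2 :
  mu_seq (s1 ++ c *: x + y :: s2) =
  c *: mu_seq (s1 ++ x :: s2) + mu_seq (s1 ++ y :: s2).
Proof.
have E s : mu_seq s = Lmu (size s) (ptens s) by case: s.
by rewrite !E ptens_linear.
Qed.

Lemma chain_linear m s1 c x y s2 :
  chain m (s1 ++ c *: x + y :: s2) =
  c *: chain m (s1 ++ x :: s2) + chain m (s1 ++ y :: s2).
Proof.
pose L n : {linear tpow (dsum A) n -> CH} :=
  (@dinj R nat CH_length n : {linear CH_length n -> CH}) \o
  (tens m : {linear tpow (dsum A) n -> CH_length n}).
exact: (ptens_linear L).
Qed.

Lemma chain_linearl s : linear (chain^~ s).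
Proof. by move=> c x y; rewrite /chain tens_linearl linearP. Qed.

Lemma muM_seq_linearl m v s1 c x y s2 :
  muM_seq (s1 ++ c *: x + y :: s2) m v =
  c *: muM_seq (s1 ++ x :: s2) m v + muM_seq (s1 ++ y :: s2) m v.
Proof.
pose L n : {linear tpow (dsum A) n -> dsum M} :=
  muM n (size v) \o linfun_of (tens_linearl (tens m (ptens v))).
exact: (ptens_linear L).
Qed.

Lemma muM_seq_linearr u m s1 c x y s2 :
  muM_seq u m (s1 ++ c *: x + y :: s2) =
  c *: muM_seq u m (s1 ++ x :: s2) + muM_seq u m (s1 ++ y :: s2).
Proof.
pose L n : {linear tpow (dsum A) n -> dsum M} :=
  muM (size u) n \o tens (ptens u) \o (tens m : {linear _ -> tensor (dsum M) (tpow (dsum A) n)}).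
exact: (ptens_linear L).
Qed.

Lemma muM_seq_linearm u v : linear (fun m => muM_seq u m v).
Proof. by move=> c x y; rewrite /muM_seq tens_linearl 2!linearP. Qed.

Let scale_comb (W : lmodType R) (k c : R) (x y : W) :
  k *: (c *: x + y) = c *: (k *: x) + k *: y.
Proof. by rewrite scalerDr !scalerA mulrC. Qed.

Lemma b_term_linearm i l a j c (x y : M j) : (0 < l)%N ->
  b_term i l (Tagged M (c *: x + y)) a =
  c *: b_term i l (Tagged M x) a + b_term i l (Tagged M y) a.
Proof.
move=> l0; rewrite /b_term hval_linear /=; case: ifP => _; first by rewrite scaler0 addr0.
case: ifP => _; first by rewrite muM_seq_linearm chain_linearl.
by case: ifP => _; rewrite ?muM_seq_linearm chain_linearl scale_comb.
Qed.

Lemma b_term_hmultilinear i l m n : (0 < l)%N -> hmultilinear n (b_term i l m).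
Proof.
move=> l0 s1 j c x y s2 Hn.
have Esz z : size (s1 ++ Tagged A z :: s2 : seq (hel A)) = n.
  by rewrite size_cat /= Hn.
have Ecr (z z' : A j) p q : mcross (s1 ++ Tagged A z :: s2) p q =
                            mcross (s1 ++ Tagged A z' :: s2) p q.
  by apply: mcross_tag; rewrite !map_cat.
rewrite /b_term !Esz !(Ecr (c *: x + y) x) !(Ecr y x) !map_cat /= hval_linear.
set X := hval (Tagged A x); set Y := hval (Tagged A y).
move: (map _ s1) (map _ s2) (size_map (@hval R A) s1) (size_map (@hval R A) s2).
move=> t1 t2 Ht1 Ht2; rewrite -{}Ht1 -{}Ht2 in Hn.
case: ifP => [_|Hl]; first by rewrite scaler0 addr0.
case: ifP => Hi.
  have [[H1 [u1 [u2 E1]]]|[H1 [u E1]]] := @slice_ins _ t1 t2 1 l.-1 isT;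
  have [[H2 [v1 [v2 E2]]]|[H2 [v E2]]] := @slice_ins _ t1 t2 l n l0;
    try (exfalso; lia); rewrite !E1 !E2.
    by rewrite muM_seq_linearr chain_linearl.
  by rewrite chain_linear.
have i0 : (0 < i)%N by lia.
case: ifP => Hil; rewrite -scale_comb; congr (_ *: _).
  have il0 : (0 < i + l)%N by lia.
  have [[H1 [u1 [u2 E1]]]|[H1 [u E1]]] := @slice_ins _ t1 t2 1 i.-1 isT;
  have [[H2 [v1 [v2 E2]]]|[H2 [v E2]]] := @slice_ins _ t1 t2 i (i + l).-1 i0;
  have [[H3 [w1 [w2 E3]]]|[H3 [w E3]]] := @slice_ins _ t1 t2 (i + l) n il0;
    try (exfalso; lia); rewrite !E1 !E2 !E3.
  - by rewrite -!catA /= chain_linear.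
  - by rewrite mu_seq_linear chain_linear.
  - by have := chain_linear (hval m) (u ++ mu_seq v :: w1) c X Y w2; rewrite -!catA.
have p0 : (0 < i + l - n - 1)%N by lia.
have [[H1 [u1 [u2 E1]]]|[H1 [u E1]]] := @slice_ins _ t1 t2 i n i0;
have [[H2 [v1 [v2 E2]]]|[H2 [v E2]]] := @slice_ins _ t1 t2 1 (i + l - n - 2) isT;
have [[H3 [w1 [w2 E3]]]|[H3 [w E3]]] := @slice_ins _ t1 t2 (i + l - n - 1) i.-1 p0;
  try (exfalso; lia); rewrite !E1 !E2 !E3.
- by rewrite muM_seq_linearl chain_linearl.
- by rewrite muM_seq_linearr chain_linearl.
- by rewrite chain_linear.
Qed.

Lemma CH_hval_uniq (W : lmodType R) (f g : {linear CH -> W}) :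
  (forall (m : hel M) (a : seq (hel A)),
     f (chain (hval m) (map (@hval R A) a)) = g (chain (hval m) (map (@hval R A) a))) ->
  f =1 g.
Proof.
move=> fg; apply: dsum_lin_uniq => n x.
pose D : {linear CH_length n -> CH} := @dinj R nat CH_length n.
apply: (@tensor_hval_uniq R M (tpow (dsum A) n) W (f \o D) (g \o D)) => m t.
pose T : {linear tpow (dsum A) n -> CH_length n} := tens (hval m).
apply: (@tpow_hval_uniq R A W n (f \o D \o T) (g \o D \o T)) => a Ha.
by move: (fg m a); rewrite /chain -ptens_atE size_map Ha.
Qed.

Lemma CH_hval_lift (W : lmodType R) (G : hel M -> seq (hel A) -> W) :
  (forall m n, hmultilinear n (G m)) ->
  (forall a j c (x y : M j),
     G (Tagged M (c *: x + y)) a = c *: G (Tagged M x) a + G (Tagged M y) a) ->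
  exists L : {linear CH -> W}, forall m a,
    L (chain (hval m) (map (@hval R A) a)) = G m a.
Proof.
move=> Ga Gm.
have Fex n : exists F : {linear CH_length n -> W},
    forall m a, size a = n -> F (tens (hval m) (ptens_at n (map (@hval R A) a))) = G m a.
  have /choice[H HH] m := tpow_hval_lift (Ga m n).
  have [j c x y t|L HL] := @tensor_hval_lift R M (tpow (dsum A) n) W H.
    have lin2 := lin_comb (H (Tagged M x)) (H (Tagged M y)) c.
    rewrite -[RHS]/(linfun_of lin2 t).
    apply: tpow_hval_uniq => a Ha.
    by rewrite HH // -[RHS]/(c *: H (Tagged M x) _ + H (Tagged M y) _) !HH.
  by exists L => m a Ha; rewrite HL HH.
have [L HL] := dlift (fun n => projT1 (cid (Fex n))).
exists L => m a; rewrite HL -ptens_atE; case: cid => F /= -> //.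
by rewrite size_map.
Qed.

Lemma is_hochschild_uniq (b b' : {linear CH -> CH}) :
  is_hochschild b -> is_hochschild b' -> b =1 b'.
Proof. by move=> Hb Hb'; apply: CH_hval_uniq => m a; rewrite Hb Hb'. Qed.

Lemma is_hochschild_exists : exists b : {linear CH -> CH}, is_hochschild b.
Proof.
pose G m a := \sum_(1 <= l < (size a).+2) \sum_(0 <= i < (size a).+1) b_term i l m a.
apply: (@CH_hval_lift CH G) => [m n s1 j c x y s2 Hn|a j c x y]; rewrite /G.
  rewrite !size_cat /= Hn scaler_sumr -big_split /=.
  apply: eq_big_nat => l /andP[l0 _]; rewrite scaler_sumr -big_split /=.
  by apply: eq_bigr => i _; rewrite (@b_term_hmultilinear i l m n).
rewrite scaler_sumr -big_split /=.
apply: eq_big_nat => l /andP[l0 _]; rewrite scaler_sumr -big_split /=.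
by apply: eq_bigr => i _; rewrite b_term_linearm.
Qed.

Definition hochschild : {linear CH -> CH} := projT1 (cid is_hochschild_exists).

Lemma hochschildE : is_hochschild hochschild.
Proof. by rewrite /hochschild; case: cid. Qed.

End Ainfty.

(* Main.v *)
Require Import Defs.
From HB Require Import structures.
From mathcomp Require Import all_boot all_order all_algebra.
From mathcomp Require Import boolp zify ring.
Import GRing.Theory.
Local Open Scope ring_scope.

Set Implicit Arguments.
Unset Strict Implicit.
Unset Printing Implicit Defensive.

(** Give every [a] in [A] its reduced degree and every [m] in [M] its degree.
    Then all operations have degree 1, and every sign in the structure equations
    and in the Hochschild differential is the Koszul sign of moving an operation
    past the letters on its left, or of rotating the cyclic word
    m a_1 ... a_n so that the letters fed to a bimodule operation become adjacent.
    So b is a sum over ways of cutting a word: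
    - [inner_term]: cut a = u v w, and replace v by mu(v);
    - [outer_term]: cut a = u v w, and replace w m u by muM(w, m, u), keeping v.

    Both terms of b applied twice produce sums over cuts of a into five pieces.
    - Two algebra operations on disjoint pieces occur twice, with opposite signs,
      since the two operations are odd; two nested ones add up to the A-infinity
      equation of A on a factor of the word ([inner_inner_vanishes]).
    - An algebra operation inside the piece v kept by an outer term occurs twice,
      with opposite signs.  The remaining terms have an algebra operation inside
      w or inside u, or two nested bimodule operations; for fixed u, v, w they add
      up to the bimodule equation for (w, m, u) ([outer_terms_cancel]).

    The bookkeeping is carried by [cutsum], the sum over all cuts of a word in two.
    It is coassociative ([cutsumA]), and cutting u x w at a point means cutting u or
    cutting w ([cutsum_insert]); the terms of b b are rearranged by these two facts.
    Inner terms with an empty v are allowed, as [mu_seq] vanishes on the empty word,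
    so that the sums run over all cuts without exception.

    As mu(v) is homogeneous of a known degree, it is again a letter: [mu_lift] and
    [muM_lift] choose homogeneous letters representing the values of the operations,
    so that the whole argument takes place on words of homogeneous letters.  There
    the degree of b is read off from the degrees of the new letters.  The indexed
    sums that define the structure equations and b are matched with sums over cuts
    in [ainfty_algebra_cuts], [ainfty_bimodule_cuts] and [hochschild_cuts]. *)

(** * Sums over the cuts of a word *)

Section Cuts.
Variables (T : Type) (V : nmodType).
Implicit Types (a u v w : seq T) (F : seq T -> seq T -> V).

Definition cutsum a F : V := \sum_(0 <= k < (size a).+1) F (take k a) (drop k a).

Lemma cutsum_nil F : cutsum [::] F = F [::] [::].
Proof. by rewrite /cutsum big_nat1. Qed.

Lemma cutsum_cons x a F :
  cutsum (x :: a) F = F [::] (x :: a) + cutsum a (fun u v => F (x :: u) v).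
Proof. by rewrite /cutsum big_nat_recl. Qed.

Lemma eq_cutsum a F G :
  (forall u v, a = u ++ v -> F u v = G u v) -> cutsum a F = cutsum a G.
Proof. by move=> FG; apply: eq_bigr => k _; apply: FG; rewrite cat_take_drop. Qed.

Lemma cutsum0 a : cutsum a (fun _ _ => 0) = 0.
Proof. exact: big1. Qed.

Lemma cutsumD a F G :
  cutsum a (fun u v => F u v + G u v) = cutsum a F + cutsum a G.
Proof. exact: big_split. Qed.

(** Coassociativity: both sides run over all cuts of [a] into three pieces. *)
Lemma cutsumA a (F : seq T -> seq T -> seq T -> V) :
  cutsum a (fun u t => cutsum t (fun v w => F u v w)) =
  cutsum a (fun t w => cutsum t (fun u v => F u v w)).
Proof.
elim: a F => [|x a IH] F; first by rewrite !cutsum_nil.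
rewrite [LHS]cutsum_cons [RHS]cutsum_cons cutsum_nil cutsum_cons -addrA IH -cutsumD.
by congr (_ + _); apply: eq_cutsum => u v _; rewrite cutsum_cons.
Qed.

Lemma cutsum_exchange a a' (F : seq T -> seq T -> seq T -> seq T -> V) :
  cutsum a (fun u v => cutsum a' (fun p q => F u v p q)) =
  cutsum a' (fun p q => cutsum a (fun u v => F u v p q)).
Proof. exact: exchange_big. Qed.

(** A cut of the word misses the letter [x], so it falls in [u] or in [w]; the cut
    just before [x] is the one at the end of [u]. *)
Lemma cutsum_insert u x w F :
  cutsum (u ++ x :: w) F =
  cutsum u (fun p q => F p (q ++ x :: w)) +
  cutsum w (fun p q => F (u ++ x :: p) q).
Proof.
elim: u F => [|y u IH] F /=; first by rewrite cutsum_nil cutsum_cons.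
by rewrite !cutsum_cons IH addrA.
Qed.

Definition cutsum3 a (F : seq T -> seq T -> seq T -> V) : V :=
  cutsum a (fun u t => cutsum t (fun v w => F u v w)).

Lemma eq_cutsum3 a (F G : seq T -> seq T -> seq T -> V) :
  (forall u v w, a = u ++ v ++ w -> F u v w = G u v w) ->
  cutsum3 a F = cutsum3 a G.
Proof.
move=> FG; apply: eq_cutsum => u t Ea; apply: eq_cutsum => v w Et.
by apply: FG; rewrite Ea Et.
Qed.

Lemma cutsum3_0 a : cutsum3 a (fun _ _ _ => 0) = 0.
Proof. by rewrite -[RHS](cutsum0 a); apply: eq_cutsum => *; apply: cutsum0. Qed.

Lemma cutsum3D a (F G : seq T -> seq T -> seq T -> V) :
  cutsum3 a (fun u v w => F u v w + G u v w) = cutsum3 a F + cutsum3 a G.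
Proof.
by rewrite /cutsum3 -cutsumD; apply: eq_cutsum => u t _; rewrite cutsumD.
Qed.

(** The letter [x] lies in the third, the second or the first piece. *)
Lemma cutsum3_insert u x w (F : seq T -> seq T -> seq T -> V) :
  cutsum3 (u ++ x :: w) F =
  cutsum3 u (fun p q r => F p q (r ++ x :: w)) +
  cutsum u (fun p q => cutsum w (fun r s => F p (q ++ x :: r) s)) +
  cutsum3 w (fun p q r => F (u ++ x :: p) q r).
Proof.
rewrite /cutsum3 cutsum_insert -cutsumD; congr (_ + _).
by apply: eq_cutsum => p q _; rewrite cutsum_insert.
Qed.

(** Cutting a word in three and then cutting some of the pieces again always runs
    once over all cuts into five; the lemmas below cover the ways in which an operation
    applied after another one can sit relative to it. *)
Section FiveFold.
Variable F : seq T -> seq T -> seq T -> seq T -> seq T -> V.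

Definition cutsum5 a : V :=
  cutsum3 a (fun u v t => cutsum3 t (fun p q r => F u v p q r)).

Lemma cutsum5_left a :
  cutsum3 a (fun u v w => cutsum3 u (fun p q r => F p q r v w)) = cutsum5 a.
Proof.
transitivity (cutsum a (fun u t => cutsum u (fun p u' => cutsum u' (fun q r =>
    cutsum t (fun v w => F p q r v w))))).
  apply: eq_cutsum => u t _; rewrite cutsum_exchange; apply: eq_cutsum => p u' _.
  by rewrite cutsum_exchange.
rewrite -cutsumA; apply: eq_cutsum => p t _.
by rewrite -cutsumA.
Qed.

Lemma cutsum5_mid a :
  cutsum3 a (fun u v w => cutsum3 v (fun p q r => F u p q r w)) = cutsum5 a.
Proof.
apply: eq_cutsum => u t _; rewrite /cutsum3 -cutsumA.
by apply: eq_cutsum => p t' _; rewrite -cutsumA.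
Qed.

Lemma cutsum5_out a :
  cutsum3 a (fun u v w => cutsum u (fun p q => cutsum w (fun r s => F p q v r s))) =
  cutsum5 a.
Proof.
transitivity (cutsum a (fun u t => cutsum u (fun p q =>
    cutsum t (fun v w => cutsum w (fun r s => F p q v r s))))).
  by apply: eq_cutsum => u t _; rewrite cutsum_exchange.
by rewrite -cutsumA.
Qed.

End FiveFold.

(** The triangle p + q < n, summed along its antidiagonals l = p + q. *)
Lemma sum_antidiagonal (G : nat -> nat -> V) n :
  \sum_(0 <= p < n) \sum_(0 <= q < (n - p)%N) G p q =
  \sum_(0 <= l < n) \sum_(0 <= q < l.+1) G (l - q)%N q.
Proof.
elim: n => [|n IH]; first by rewrite !big_geq.
rewrite [RHS]big_nat_recr //= -IH [LHS]big_nat_recr //= subSnn.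
rewrite [X in _ = _ + X]big_nat_rev /= [X in _ = _ + X]big_nat_recr //= addrA.
rewrite big_nat1 add0n subSS subnn subn0; congr (_ + _).
rewrite -big_split /=; apply: eq_big_nat => p /andP[_ pn].
rewrite subSn 1?ltnW // big_nat_recr //=; congr (_ + G _ _); lia.
Qed.

Lemma sum_triangle_exchange (G : nat -> nat -> V) n :
  \sum_(0 <= p < n) \sum_(0 <= q < (n - p)%N) G p q =
  \sum_(0 <= q < n) \sum_(0 <= p < (n - q)%N) G p q.
Proof.
rewrite sum_antidiagonal (sum_antidiagonal (fun q p => G p q)).
apply: eq_bigr => l _; rewrite big_nat_rev /=; apply: eq_big_nat => q /andP[_ ql].
by congr (G _ _); lia.
Qed.

(** Indexed by the length of the middle piece, as the structure equations are. *)
Lemma cutsum3E a (F : seq T -> seq T -> seq T -> V) : cutsum3 a F =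
  \sum_(0 <= n < (size a).+1) \sum_(0 <= k < ((size a).+1 - n)%N)
    F (take k a) (take n (drop k a)) (drop (k + n) a).
Proof.
rewrite -sum_triangle_exchange; apply: eq_big_nat => k /andP[_ kn].
rewrite /cutsum size_drop -subSn //; apply: eq_bigr => n _.
by rewrite drop_drop addnC.
Qed.

(** Indexed by the total length [l] of the two outer pieces, which is the number of
    letters of A fed to the bimodule operation in an outer term. *)
Lemma cutsum3_outerE a (F : seq T -> seq T -> seq T -> V) : cutsum3 a F =
  \sum_(0 <= l < (size a).+1) \sum_(0 <= q < l.+1)
   let n := size a in
    F (take (l - q) a) (take (n - l) (drop (l - q) a)) (drop (n - q) a).
Proof.
transitivity (\sum_(0 <= p < (size a).+1) \sum_(0 <= q < ((size a).+1 - p)%N)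
  F (take p a) (take (size a - (p + q)) (drop p a)) (drop (size a - q) a)).
  apply: eq_big_nat => p /andP[_ pn].
  rewrite /cutsum size_drop big_nat_rev /= subSn //; apply: eq_big_nat => q /andP[_ qn].
  by rewrite drop_drop; congr (F _ (take _ _) (drop _ _)); lia.
rewrite sum_antidiagonal; apply: eq_bigr => l _; apply: eq_big_nat => q /andP[_ ql].
by rewrite subnK.
Qed.

End Cuts.

Lemma cutsum_additive (T : Type) (V W : nmodType) (f : {additive V -> W})
    (a : seq T) (F : seq T -> seq T -> V) :
  f (cutsum a F) = cutsum a (fun u v => f (F u v)).
Proof. exact: raddf_sum. Qed.

Lemma cutsum3_additive (T : Type) (V W : nmodType) (f : {additive V -> W})
    (a : seq T) (F : seq T -> seq T -> seq T -> V) :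
  f (cutsum3 a F) = cutsum3 a (fun u v w => f (F u v w)).
Proof.
by rewrite cutsum_additive; apply: eq_cutsum => u t _; apply: cutsum_additive.
Qed.

Lemma cutsum3N (T : Type) (V : zmodType)
    (a : seq T) (F : seq T -> seq T -> seq T -> V) :
  cutsum3 a (fun u v w => - F u v w) = - cutsum3 a F.
Proof. by symmetry; apply: (cutsum3_additive (GRing.opp : {additive V -> V})). Qed.

(** * Signs and reduced degrees *)

Section Signs.
Variable R : pzRingType.
Implicit Types x y z : int.

Lemma sgnD x y : sgn R (x + y) = sgn R x * sgn R y.
Proof.
rewrite /sgn -exprD -[LHS]signr_odd -[RHS]signr_odd; congr (_ ^+ nat_of_bool _).
lia.
Qed.

Lemma sgn_even y x z : x = y + 2 * z -> sgn R x = sgn R y.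
Proof.
move=> ->; rewrite /sgn -[LHS]signr_odd -[RHS]signr_odd.
congr (_ ^+ nat_of_bool _); lia.
Qed.

Lemma sgn_odd y x z : x = y + 1 + 2 * z -> sgn R x = - sgn R y.
Proof. by move/sgn_even->; rewrite sgnD mulrN1. Qed.

End Signs.

Section Words.
Variables (R : comPzRingType) (A : int -> lmodType R).

Definition rdegs (a : seq (hel A)) : int := \sum_(x <- a) rdeg x.

Lemma rdegs_nil : rdegs [::] = 0. Proof. exact: big_nil. Qed.
Lemma rdegs_cons x a : rdegs (x :: a) = rdeg x + rdegs a.
Proof. exact: big_cons. Qed.
Lemma rdegs_cat a a' : rdegs (a ++ a') = rdegs a + rdegs a'.
Proof. exact: big_cat. Qed.

Lemma rdegsE a : rdegs a = \sum_(x <- a) tag x - (size a)%:Z.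
Proof.
elim: a => [|x a IH]; first by rewrite rdegs_nil big_nil.
rewrite rdegs_cons big_cons IH /rdeg /= -addn1 PoszD; ring.
Qed.

End Words.

(** * The relations between operations on words imply b b = 0 *)

Section Square.
Variables (R : comPzRingType) (A M : int -> lmodType R).
Variable mu : forall n, {linear tpow (dsum A) n.+1 -> dsum A}.
Variable muM : forall r s,
  {linear tensor (tpow (dsum A) r) (tensor (dsum M) (tpow (dsum A) s)) -> dsum M}.

Local Notation hvals := (map (@hval R A)).
Local Notation "± k" := (sgn R k) (at level 10).

Variable muH : seq (hel A) -> hel A.
Variable muMH : seq (hel A) -> hel M -> seq (hel A) -> hel M.
Hypothesis muHE : forall a, hval (muH a) = mu_seq mu (hvals a).
Hypothesis rdeg_muH : forall a, rdeg (muH a) = rdegs a + 1.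
Hypothesis muMHE : forall u m v,
  hval (muMH u m v) = muM_seq muM (hvals u) (hval m) (hvals v).
Hypothesis tag_muMH : forall u m v,
  tag (muMH u m v) = rdegs u + tag m + rdegs v + 1.

Hypothesis ainf : forall a,
  cutsum3 a (fun u v w => ± (rdegs u) *: mu_seq mu (hvals (u ++ muH v :: w))) = 0.
Hypothesis bimod : forall a m a',
  cutsum3 a (fun u v w => ± (rdegs u) *:
    muM_seq muM (hvals (u ++ muH v :: w)) (hval m) (hvals a')) +
  cutsum a' (fun p q => cutsum a (fun u v => ± (rdegs u) *:
    muM_seq muM (hvals u) (hval (muMH v m p)) (hvals q))) +
  cutsum3 a' (fun u v w => ± (rdegs a + tag m + rdegs u) *:
    muM_seq muM (hvals a) (hval m) (hvals (u ++ muH v :: w))) = 0.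

Definition word_chain (m : hel M) (a : seq (hel A)) : CH A M :=
  chain (hval m) (hvals a).

Definition inner_term m u v w : CH A M :=
  ± (tag m + rdegs u) *: word_chain m (u ++ muH v :: w).
Definition outer_term m u v w : CH A M :=
  ± ((tag m + rdegs u + rdegs v) * rdegs w) *: word_chain (muMH w m u) v.

Variable b : {linear CH A M -> CH A M}.
Hypothesis bE : forall m a, b (word_chain m a) =
  cutsum3 a (inner_term m) + cutsum3 a (outer_term m).

(** The A-infinity equation inside a chain: a chain is linear in each of its entries. *)
Lemma inner_relation m p a q :
  cutsum3 a (fun u v w => ± (rdegs u) *:
    word_chain m (p ++ muH (u ++ muH v :: w) :: q)) = 0.
Proof.
have lin : linear (fun y => chain (hval m) (hvals p ++ y :: hvals q)).
  by move=> c x y; apply: chain_linear.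
have := congr1 (linfun_of lin) (ainf a).
rewrite linear0 cutsum3_additive => <-; apply: eq_cutsum3 => u v w _.
by rewrite [RHS](linearZ_LR (linfun_of lin)) /= -muHE -[RHS]/(_ *: chain _ _)
  /word_chain [hvals (p ++ _)]map_cat.
Qed.

(** The bimodule equation in the first entry of a chain. *)
Lemma outer_relation m w v u :
  cutsum3 w (fun p q r => ± (rdegs p) *:
    word_chain (muMH (p ++ muH q :: r) m u) v) +
  cutsum u (fun p q => cutsum w (fun r s => ± (rdegs r) *:
    word_chain (muMH r (muMH s m p) q) v)) +
  cutsum3 u (fun p q r => ± (rdegs w + tag m + rdegs p) *:
    word_chain (muMH w m (p ++ muH q :: r)) v) = 0.
Proof.
have lin : linear (fun y : dsum M => chain y (hvals v) : CH A M).
  exact: chain_linearl.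
have := congr1 (linfun_of lin) (bimod w m u).
rewrite linear0 !raddfD /= !cutsum3_additive cutsum_additive => <-.
congr (_ + _ + _); first 1 last.
- apply: eq_cutsum => p q _; rewrite cutsum_additive; apply: eq_cutsum => r s _.
  by rewrite [RHS](linearZ_LR (linfun_of lin)) /= -muMHE.
- by apply: eq_cutsum3 => p q r _; rewrite [RHS](linearZ_LR (linfun_of lin)) /= -muMHE.
by apply: eq_cutsum3 => p q r _; rewrite [RHS](linearZ_LR (linfun_of lin)) /= -muMHE.
Qed.

(** Disjoint operations cancel in pairs, as swapping two odd operations changes the
    sign; nested operations are collected by [inner_relation]. *)
Lemma inner_inner_vanishes m a :
  cutsum3 a (fun u v w =>
    ± (tag m + rdegs u) *: cutsum3 (u ++ muH v :: w) (inner_term m)) = 0.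
Proof.
(* The sign of applying mu first to [v] and then to the piece after [p]; in the other
   order, the summand 1, which comes from the degree of mu(v), is absent. *)
pose s (u v p : seq (hel A)) : R :=
  ± (tag m + rdegs u) * ± (tag m + rdegs u + rdegs v + 1 + rdegs p).
transitivity (
  cutsum5 (fun u v p q r =>
     - (s u v p *: word_chain m (u ++ muH v :: p ++ muH q :: r))) a +
  cutsum5 (fun u p v q r => ± (rdegs p) *: word_chain m (u ++ muH (p ++ muH v :: q) :: r)) a +
  cutsum5 (fun u v p q r =>
     s u v p *: word_chain m (u ++ muH v :: p ++ muH q :: r)) a).
  rewrite -(cutsum5_left _ a) -(cutsum5_out _ a) -!cutsum3D.
  apply: eq_cutsum3 => u v w _; rewrite cutsum3_insert !scalerDr.
  congr (_ + _ + _).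
  - rewrite cutsum3_additive; apply: eq_cutsum3 => p q r ->.
    rewrite /inner_term /= scalerA -scaleNr; congr (_ *: _).
    rewrite /s -!sgnD !rdegs_cat.
    apply: (@sgn_odd _ _ _ (-1)); ring.
  - rewrite cutsum_additive; apply: eq_cutsum => p q ->.
    rewrite cutsum_additive; apply: eq_cutsum => r t _.
    rewrite /inner_term /= scalerA -sgnD; congr (_ *: _); rewrite !rdegs_cat.
    apply: (@sgn_even _ _ _ (tag m + rdegs p)); ring.
  rewrite cutsum3_additive; apply: eq_cutsum3 => p q r _.
  rewrite /inner_term /= scalerA -!catA /=; congr (_ *: _).
  by rewrite /s rdegs_cat rdegs_cons rdeg_muH; congr (_ * ± _); ring.
rewrite addrAC -cutsum3D.
rewrite [X in X + _](_ : _ = 0) ?add0r; last first.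
  rewrite -[RHS](cutsum3_0 _ a); apply: eq_cutsum3 => u v t _; rewrite -cutsum3D.
  by rewrite -[RHS](cutsum3_0 _ t); apply: eq_cutsum3 => p q r _; rewrite addNr.
rewrite -(cutsum5_mid _ a) -[RHS](cutsum3_0 _ a); apply: eq_cutsum3 => u v w _.
exact: inner_relation.
Qed.

(** The first sum splits into [L], [C] and [U], according to whether the letter produced
    by the first operation is used on the left of m by the second one, is kept, or is
    used on the right of m.  The second sum is [- C], the third one is the sum [N] of
    nested bimodule operations, and [L + N + U] is a combination of instances of
    [outer_relation]. *)
Lemma outer_terms_cancel m a :
  cutsum3 a (fun u v w =>
    ± (tag m + rdegs u) *: cutsum3 (u ++ muH v :: w) (outer_term m)) +
  (cutsum3 a (fun u v w => ± ((tag m + rdegs u + rdegs v) * rdegs w) *: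
    cutsum3 v (inner_term (muMH w m u))) +
  cutsum3 a (fun u v w => ± ((tag m + rdegs u + rdegs v) * rdegs w) *:
    cutsum3 v (outer_term (muMH w m u)))) = 0.
Proof.
(* The exponent of the sign for rotating [w] in front of [m u v]. *)
pose e (u v w : seq (hel A)) := (tag m + rdegs u + rdegs v) * rdegs w.
pose L p q r v w : CH A M := ± (e p q (r ++ v ++ w) + rdegs r) *:
  word_chain (muMH (r ++ muH v :: w) m p) q.
pose C p q v r s : CH A M :=
  ± (tag m + rdegs p + rdegs q + (e p (q ++ v ++ r) s + rdegs s)) *:
  word_chain (muMH s m p) (q ++ muH v :: r).
pose U u v p q r : CH A M := ± (e (u ++ v ++ p) q r + (rdegs r + tag m + rdegs u)) *:
  word_chain (muMH r m (u ++ muH v :: p)) q.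
pose N u p q r w : CH A M := ± (e (u ++ p) q (r ++ w) + rdegs r) *:
  word_chain (muMH r (muMH w m u) p) q.
transitivity (cutsum5 L a + cutsum5 C a + cutsum5 U a +
              (- cutsum5 C a + cutsum5 N a)).
  congr (_ + (_ + _)).
  - rewrite -(cutsum5_left L a) -(cutsum5_out C a) -!cutsum3D.
    apply: eq_cutsum3 => u v w _; rewrite cutsum3_insert !scalerDr.
    congr (_ + _ + _).
    + rewrite cutsum3_additive; apply: eq_cutsum3 => p q r ->.
      rewrite /outer_term /L /= scalerA -sgnD; congr (_ *: _).
      rewrite /e !rdegs_cat rdegs_cons rdeg_muH.
      apply: (@sgn_even _ _ _ (tag m + rdegs p + rdegs q)); ring.
    + rewrite cutsum_additive; apply: eq_cutsum => p q ->.
      rewrite cutsum_additive; apply: eq_cutsum => r t _.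
      rewrite /outer_term /C /= scalerA -sgnD; congr (_ *: _).
      rewrite /e !rdegs_cat rdegs_cons rdeg_muH; congr (± _); ring.
    rewrite cutsum3_additive; apply: eq_cutsum3 => p q r _.
    rewrite /outer_term /U /= scalerA -sgnD; congr (_ *: _).
    rewrite /e !rdegs_cat rdegs_cons rdeg_muH; congr (± _); ring.
  - rewrite -(cutsum5_mid C a) -cutsum3N; apply: eq_cutsum3 => u v w _.
    rewrite cutsum3_additive -cutsum3N; apply: eq_cutsum3 => p q r ->.
    rewrite /inner_term /C /= scalerA -sgnD -scaleNr; congr (_ *: _).
    rewrite /e !rdegs_cat tag_muMH.
    apply: (@sgn_odd _ _ _ 0); ring.
  rewrite -(cutsum5_mid N a); apply: eq_cutsum3 => u v w _.
  rewrite cutsum3_additive; apply: eq_cutsum3 => p q r ->.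
  rewrite /outer_term /N /= scalerA -sgnD; congr (_ *: _).
  rewrite /e !rdegs_cat tag_muMH.
  apply: (@sgn_even _ _ _ (rdegs w * rdegs r)); ring.
rewrite (addrAC (cutsum5 L a)) addrA addrK -addrA (addrC (cutsum5 U a)) addrA.
rewrite -(cutsum5_out N a) -(cutsum5_left U a) -!cutsum3D.
rewrite -[RHS](cutsum3_0 _ a); apply: eq_cutsum3 => u v w _.
rewrite -[RHS](scaler0 _ (± (e u v w))) -(outer_relation m w v u) !scalerDr.
rewrite !cutsum3_additive cutsum_additive; congr (_ + _ + _).
- apply: eq_cutsum3 => p q r ->.
  by rewrite /L /= scalerA -sgnD.
- apply: eq_cutsum => p q ->; rewrite cutsum_additive; apply: eq_cutsum => r s ->.
  by rewrite /N /= scalerA -sgnD.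
apply: eq_cutsum3 => p q r ->.
by rewrite /U /= scalerA -sgnD.
Qed.

Lemma square_zero_of_relations x : b (b x) = 0.
Proof.
pose f : {linear CH A M -> CH A M} := b \o b.
rewrite -[LHS]/(f x) -[RHS]/((\0 : {linear CH A M -> CH A M}) x).
move: x; apply: CH_hval_uniq => m a; rewrite -/(word_chain m a) /= bE.
rewrite raddfD /= !cutsum3_additive.
have inner_b : cutsum3 a (fun u v w => b (inner_term m u v w)) =
    cutsum3 a (fun u v w =>
      ± (tag m + rdegs u) *: cutsum3 (u ++ muH v :: w) (inner_term m)) +
    cutsum3 a (fun u v w =>
      ± (tag m + rdegs u) *: cutsum3 (u ++ muH v :: w) (outer_term m)).
  rewrite -cutsum3D; apply: eq_cutsum3 => u v w _.
  by rewrite /inner_term (linearZ_LR b) /= bE scalerDr.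
have outer_b : cutsum3 a (fun u v w => b (outer_term m u v w)) =
    cutsum3 a (fun u v w => ± ((tag m + rdegs u + rdegs v) * rdegs w) *:
      cutsum3 v (inner_term (muMH w m u))) +
    cutsum3 a (fun u v w => ± ((tag m + rdegs u + rdegs v) * rdegs w) *:
      cutsum3 v (outer_term (muMH w m u))).
  rewrite -cutsum3D; apply: eq_cutsum3 => u v w _.
  by rewrite /outer_term (linearZ_LR b) /= bE scalerDr.
by rewrite inner_b outer_b inner_inner_vanishes add0r outer_terms_cancel.
Qed.

(** The degree of a chain in terms of reduced degrees, which are additive under the
    operations up to the shift by 1. *)
Lemma CH_part_word_chain m a : CH_part (- tag m - rdegs a) (word_chain m a).
Proof.
apply: lin_span_incl; exists m, a; split=> //.
rewrite rdegsE; ring.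
Qed.

Lemma CH_part_cutsum3 j a (F : seq (hel A) -> seq (hel A) -> seq (hel A) -> CH A M) :
  (forall u v w, a = u ++ v ++ w -> CH_part j (F u v w)) -> CH_part j (cutsum3 a F).
Proof.
have sumP N (G : nat -> CH A M) : (forall k, CH_part j (G k)) ->
    CH_part j (\sum_(0 <= k < N) G k).
  by move=> GP; elim/big_ind: _ => // [|x y]; [apply: Span0 | apply: lin_spanD].
move=> FP; apply: (sumP) => k; apply: (sumP) => l; apply: FP.
by rewrite !cat_take_drop.
Qed.

Lemma lowers_degree j x : CH_part j x -> CH_part (j - 1) (b x).
Proof.
elim=> [|c z y [m [a [-> ->]]] _ IH]; first by rewrite linear0; apply: Span0.
rewrite linearP; apply: lin_spanD IH; apply: lin_spanZ.
rewrite -/(word_chain m a) bE.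
have Ea : (size a)%:Z - tag m - \sum_(y <- a) tag y = - tag m - rdegs a.
  by rewrite rdegsE; ring.
rewrite Ea; apply: lin_spanD; apply: CH_part_cutsum3 => u v w ->; apply: lin_spanZ.
  rewrite (_ : _ - 1 = - tag m - rdegs (u ++ muH v :: w)); last first.
    rewrite !rdegs_cat rdegs_cons rdeg_muH; ring.
  exact: CH_part_word_chain.
rewrite (_ : _ - 1 = - tag (muMH w m u) - rdegs v); last first.
  rewrite !rdegs_cat tag_muMH; ring.
exact: CH_part_word_chain.
Qed.

End Square.

(** * Indexed sums of slices as sums over cuts *)

Lemma slice1 (T : Type) (s : seq T) k : slice s 1 k = take k s.
Proof. by rewrite /slice subn1 drop0. Qed.

Lemma sliceE (T : Type) (s : seq T) k j : slice s k.+1 j = drop k (take j s).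
Proof.
rewrite /slice subSS /=; case: (leqP k j) => [kj|jk].
  by rewrite take_drop subnK.
by rewrite (eqP (ltnW jk)) take0 drop_oversize // size_take_min; lia.
Qed.

Lemma sliceD (T : Type) (s : seq T) k n : slice s k.+1 (k + n) = take n (drop k s).
Proof. by rewrite sliceE [RHS]take_drop addnC. Qed.

Lemma slice_catl (T : Type) (s t : seq T) r k j : size s = r -> (j <= r)%N ->
  slice (s ++ t) k.+1 j = slice s k.+1 j.
Proof. by move=> <- jr; rewrite !sliceE takel_cat. Qed.

Lemma slice_catr (T : Type) (s t : seq T) r k j : size s = r ->
  slice (s ++ t) (r + k).+1 (r + j) = slice t k.+1 j.
Proof.
move=> <-; rewrite !sliceE takeD (take_size_cat t erefl) (drop_size_cat t erefl).
by rewrite addnC -drop_drop drop_size_cat.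
Qed.

Lemma slice_end (T : Type) (s : seq T) k n : (size s <= n)%N ->
  slice s k.+1 n = drop k s.
Proof. by move=> sn; rewrite /slice take_oversize // size_drop subSS leq_sub2r. Qed.

Lemma big_nat_shift (V : nmodType) (F : nat -> V) n :
  \sum_(1 <= i < n.+1) F i = \sum_(0 <= i < n) F i.+1.
Proof. by rewrite big_add1. Qed.

(** The index [i] is the position of the first letter of the middle piece, counted from
    1, and [n] is the length of that piece. *)
Lemma middle_cutsE (T : Type) (V : nmodType) (a : seq T)
    (F : seq T -> seq T -> seq T -> V) :
  (forall u w, F u [::] w = 0) ->
  cutsum3 a F =
  \sum_(1 <= n < (size a).+1) \sum_(1 <= i < ((size a).+2 - n)%N)
     F (take i.-1 a) (take n (drop i.-1 a)) (drop (i.-1 + n) a).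
Proof.
move=> F0; rewrite cutsum3E big_nat_recl // [X in X + _]big1 ?add0r; last first.
  by move=> k _; rewrite take0.
rewrite [RHS]big_nat_shift; apply: eq_big_nat => n /andP[_ nr].
by rewrite !subSS subSn 1?ltnW // big_nat_shift.
Qed.

(** The form found in the bimodule equation, where [p] is the number of letters left
    once the middle piece has become one letter; [p = 0] gives an empty sum. *)
Lemma middle_cuts_revE (T : Type) (V : nmodType) (a : seq T)
    (F : seq T -> seq T -> seq T -> V) :
  (forall u w, F u [::] w = 0) ->
  cutsum3 a F =
  \sum_(0 <= p < (size a).+1) \sum_(1 <= i < p.+1)
     (let n := ((size a).+1 - p)%N in
      F (take i.-1 a) (take n (drop i.-1 a)) (drop (i.-1 + n) a)).
Proof.
move=> F0; rewrite middle_cutsE // big_nat_rev /= [RHS]big_nat_recl //.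
rewrite [X in _ = X + _]big_geq // add0r big_nat_shift.
apply: eq_big_nat => n /andP[_ nr].
rewrite (_ : 1 + (size a).+1 - n.+2 = (size a).+1 - n.+1)%N //.
by rewrite (_ : (size a).+2 - _ = n.+2)%N //; lia.
Qed.

(** * The structure equations and the differential on words of letters *)

Section Translate.
Variables (R : comPzRingType) (A M : int -> lmodType R).
Variable mu : forall n, {linear tpow (dsum A) n.+1 -> dsum A}.
Variable muM : forall r s,
  {linear tensor (tpow (dsum A) r) (tensor (dsum M) (tpow (dsum A) s)) -> dsum M}.
Local Notation hvals := (map (@hval R A)).
Local Notation "± k" := (sgn R k) (at level 10).
Hypothesis hA : ainfty_algebra mu.
Hypothesis hM : ainfty_bimodule mu muM.

Lemma mu_seq0 p q : mu_seq mu (p ++ 0 :: q) = 0.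
Proof.
by have := mu_seq_linear mu p (-1) 0 0 q; rewrite !scaleN1r oppr0 addr0 addNr.
Qed.

Lemma muM_seq0l m v p q : muM_seq muM (p ++ 0 :: q) m v = 0.
Proof.
by have := muM_seq_linearl muM m v p (-1) 0 0 q; rewrite !scaleN1r oppr0 addr0 addNr.
Qed.

Lemma muM_seq0r u m p q : muM_seq muM u m (p ++ 0 :: q) = 0.
Proof.
by have := muM_seq_linearr muM u m p (-1) 0 0 q; rewrite !scaleN1r oppr0 addr0 addNr.
Qed.

Lemma chain0 (m : dsum M) p q : chain m (p ++ 0 :: q) = 0 :> CH A M.
Proof.
by have := chain_linear m p (-1) 0 0 q; rewrite !scaleN1r oppr0 addr0 addNr.
Qed.

(** On the empty word, where [mu_seq] is 0, the zero of degree 2 is chosen: it makes the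
    degree formula hold without exception. *)
Lemma mu_lift : exists f : seq (hel A) -> hel A, forall a,
  hval (f a) = mu_seq mu (hvals a) /\ rdeg (f a) = rdegs a + 1.
Proof.
suff /choice[f fE] : forall a, exists y, hval y = mu_seq mu (hvals a) /\
    rdeg y = rdegs a + 1 by exists f.
case=> [|x a].
  exists (Tagged A (0 : A 2)); split; first exact: linear0.
  by rewrite rdegs_nil.
have [y Ey] := hA.1 (x :: a) isT.
exists (Tagged A y); split; first exact/esym.
by rewrite rdegsE /rdeg /=; ring.
Qed.

Lemma muM_lift : exists f : seq (hel A) -> hel M -> seq (hel A) -> hel M,
  forall u m v, hval (f u m v) = muM_seq muM (hvals u) (hval m) (hvals v) /\
    tag (f u m v) = rdegs u + tag m + rdegs v + 1.
Proof.
have /choice[f fE] : forall t : seq (hel A) * hel M * seq (hel A), exists y : hel M,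
    hval y = muM_seq muM (hvals t.1.1) (hval t.1.2) (hvals t.2) /\
    tag y = rdegs t.1.1 + tag t.1.2 + rdegs t.2 + 1.
  case=> -[u m] v; have [y Ey] := hM.1 u m v.
  by exists (Tagged M y); split; [exact/esym|rewrite /= !rdegsE; ring].
by exists (fun u m v => f (u, m, v)) => u m v; apply: (fE (u, m, v)).
Qed.

Variable muH : seq (hel A) -> hel A.
Variable muMH : seq (hel A) -> hel M -> seq (hel A) -> hel M.
Hypothesis muHE : forall a, hval (muH a) = mu_seq mu (hvals a).
Hypothesis muMHE : forall u m v,
  hval (muMH u m v) = muM_seq muM (hvals u) (hval m) (hvals v).

Lemma ainfty_algebra_cuts a :
  cutsum3 a (fun u v w => ± (rdegs u) *: mu_seq mu (hvals (u ++ muH v :: w))) = 0.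
Proof.
rewrite middle_cutsE; last first.
  by move=> u w; rewrite map_cat /= muHE mu_seq0 scaler0.
have [a0|a_gt0] := posnP (size a); first by rewrite a0 big_geq.
rewrite -[RHS](hA.2 a a_gt0); apply: eq_bigr => n _.
apply: eq_big_nat => -[//|k] /andP[_ kn].
rewrite /mcross !slice1 /=; congr (_ *: _).
rewrite map_cat /= muHE !map_take !map_drop.
by rewrite addSn /= sliceD slice_end ?size_map.
Qed.

Lemma ainfty_bimodule_cuts a m a' :
  cutsum3 a (fun u v w => ± (rdegs u) *:
    muM_seq muM (hvals (u ++ muH v :: w)) (hval m) (hvals a')) +
  cutsum a' (fun p q => cutsum a (fun u v => ± (rdegs u) *:
    muM_seq muM (hvals u) (hval (muMH v m p)) (hvals q))) +
  cutsum3 a' (fun u v w => ± (rdegs a + tag m + rdegs u) *: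
    muM_seq muM (hvals a) (hval m) (hvals (u ++ muH v :: w))) = 0.
Proof.
have sz : size (hvals a) = size a by rewrite size_map.
have sz' : size (hvals a') = size a' by rewrite size_map.
have slice_a' : slice (hvals a ++ hvals a') (size a).+1 (size a + size a') = hvals a'.
  by rewrite -[in (size a).+1](addn0 (size a)) slice_catr // slice_end ?drop0 ?sz'.
rewrite -[RHS](hM.2 (size a) (size a') (a ++ a') m (size_cat _ _)).
rewrite !map_cat slice_a'; congr (_ + _ + _).
- rewrite middle_cuts_revE; last first.
    by move=> u w; rewrite map_cat /= muHE muM_seq0l scaler0.
  apply: eq_big_nat => p /andP[_ pr]; apply: eq_big_nat => -[//|k] /andP[_ kp].
  set n := ((size a).+1 - p)%N; have kn : (k + n <= size a)%N by rewrite /n; lia.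
  have ka : (k <= size a)%N by lia.
  rewrite /= /mcross !slice1 !takel_cat ?sz //; congr (_ *: muM_seq _ _ _ _).
  rewrite map_cat /= muHE !map_take !map_drop.
  by rewrite addSn /= !(slice_catl _ _ sz) // sliceD slice_end ?sz.
- rewrite /cutsum exchange_big /=; apply: eq_big_nat => p /andP[_ pr].
  apply: eq_big_nat => q /andP[_ qs].
  rewrite /mcross !slice1 !takel_cat ?sz //; congr (_ *: _).
  rewrite muMHE (slice_catl _ _ sz) // slice_catr //.
  rewrite -[in (size a).+1](addn0 (size a)) slice_catr // slice1.
  rewrite [slice _ p.+1 _]slice_end ?sz // [slice _ q.+1 _]slice_end ?sz' //.
  by rewrite !map_take !map_drop.
rewrite middle_cuts_revE; last first.
  by move=> u w; rewrite map_cat /= muHE muM_seq0r scaler0.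
apply: eq_big_nat => p /andP[_ pr]; apply: eq_big_nat => -[//|k] /andP[_ kp].
set n := ((size a').+1 - p)%N.
rewrite /= /mcross !addnS /= !slice1 takeD (take_size_cat a' erefl).
rewrite (drop_size_cat a' erefl).
rewrite (take_size_cat _ sz) -/(rdegs _) rdegs_cat.
rewrite [in RHS]addrAC.
rewrite map_cat /= muHE !map_take !map_drop addSn /= -addnA.
rewrite -[in (size a).+1](addn0 (size a)) !slice_catr // slice1 sliceD.
by rewrite slice_end ?sz'.
Qed.

(** In the definition of b, the term of index [i] with 1 <= i <= n + 1 - l is an inner
    one.  The other terms are outer ones with last piece w of length q, where
    i = n + 1 - q if q > 0, while i = 0 stands for q = 0; the first piece u then has
    length l - 1 - q in both cases. *)
Lemma hochschild_cuts m a : hochschild mu muM (word_chain m a) =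
  cutsum3 a (inner_term muH m) + cutsum3 a (outer_term muMH m).
Proof.
rewrite [LHS]hochschildE.
set n := size a; have szx : size (hvals a) = n by rewrite size_map.
rewrite middle_cutsE; last first.
  by move=> u w; rewrite /inner_term /word_chain map_cat /= muHE chain0 scaler0.
rewrite -/n cutsum3_outerE -/n !big_nat_shift.
have -> (G : nat -> nat -> CH A M) :
    \sum_(0 <= l < n) \sum_(1 <= i < (n.+2 - l.+1)%N) G l i =
    \sum_(0 <= l < n.+1) \sum_(1 <= i < (n.+2 - l.+1)%N) G l i.
  by rewrite [RHS]big_nat_recr //= [X in _ = _ + X]big_geq ?addr0 // subSS subSnn.
rewrite -big_split /=; apply: eq_big_nat => l /andP[_ ln].
(* The index 0, the indices of inner terms, and those of outer terms with i > 0. *)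
rewrite big_ltn // (@big_cat_nat _ _ _ (n.+1 - l)%N) /=; [|lia|lia].
rewrite [X in _ + (_ + X)](big_addn 0 n.+1 (n.+1 - l)%N) subKn 1?ltnW //.
rewrite [X in _ + (_ + X)]big_nat_rev /=.
rewrite [X in _ = _ + X]big_nat_recl //= addrCA; congr (_ + (_ + _)).
- rewrite subSS; apply: eq_big_nat => -[//|k] /andP[_ kn].
  rewrite /b_term -/n ifF; last by lia.
  rewrite /= ifT; last by lia.
  rewrite /mcross slice1 /=; congr (_ *: chain _ _).
  rewrite map_cat /= muHE !map_take !map_drop slice1.
  by rewrite addSn /= sliceD slice_end ?szx.
- rewrite /b_term -/n ifF; last by lia.
  rewrite /= /outer_term !subn0 (drop_size a : drop n a = [::]) rdegs_nil mulr0.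
  rewrite /sgn expr0 scale1r.
  rewrite /word_chain muMHE slice1 map_take slice_end ?szx //.
  by rewrite (@take_oversize _ _ (drop l a)) ?map_drop // size_drop.
apply: eq_big_nat => q /andP[_ ql].
rewrite (_ : (0 + l - q.+1 + (n.+1 - l) = (n - q.+1).+1)%N); last by lia.
set k := (n - q.+1)%N; set p := (l - q.+1)%N.
have Ek : k = (p + (n - l))%N by rewrite /k /p; lia.
rewrite /b_term -/n ifF; last by lia.
rewrite /= ifF; last by lia.
rewrite (_ : (k.+1 + l.+1 - n - 2 = p)%N); last by rewrite /p /k; lia.
rewrite (_ : (k.+1 + l.+1 - n - 1 = p.+1)%N); last by rewrite /p /k; lia.
rewrite /outer_term /word_chain muMHE /mcross !slice1.
rewrite [slice a k.+1 _]slice_end // [slice (hvals a) k.+1 _]slice_end ?szx //.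
rewrite -!/(rdegs _).
rewrite -addrA -rdegs_cat -takeD -Ek; congr (_ *: chain (muM_seq _ _ _ _) _).
- by rewrite map_drop.
- by rewrite map_take.
by rewrite Ek sliceD map_take map_drop.
Qed.

End Translate.

Theorem theorem2p5 (R : comPzRingType) (A M : int -> lmodType R)
    (mu : forall n : nat, {linear tpow (dsum A) n.+1 -> dsum A})
    (muM : forall r s : nat,
       {linear tensor (tpow (dsum A) r) (tensor (dsum M) (tpow (dsum A) s)) -> dsum M})
    (hA : ainfty_algebra mu) (hM : ainfty_bimodule mu muM) :
  (forall x : CH A M, hochschild mu muM (hochschild mu muM x) = 0) /\
  (forall (j : int) (x : CH A M),
     CH_part j x -> CH_part (j - 1) (hochschild mu muM x)).
Proof.
have [muH muHP] := mu_lift hA; have [muMH muMHP] := muM_lift hM.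
have muHE a := (muHP a).1; have rdeg_muH a := (muHP a).2.
have muMHE u m v := (muMHP u m v).1; have tag_muMH u m v := (muMHP u m v).2.
have bE := hochschild_cuts muHE muMHE.
have ainf := ainfty_algebra_cuts hA muHE.
have bimod := ainfty_bimodule_cuts hM muHE muMHE.
split=> [x|j x].
  exact: (square_zero_of_relations muHE rdeg_muH muMHE tag_muMH ainf bimod bE).
exact: (lowers_degree rdeg_muH tag_muMH bE).
Qed.
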